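(* The following conditions are equivalent for an associative ring $R$ with identity: (a) $Max(R)$ is a normal space. (b) The frame $SPm(R)$ is normal.
   Context: Rings are associative with identity, not necessarily commutative; ''ideal'' means two-sided ideal. $R$ is regarded as a left $R$-module over itself. $Max(R)$ is the set of maximal submodules of ${}_RR$, i.e. maximal left ideals, with the topology whose closed sets are $\{\mathcal{M}\in Max(R)\mid I\subseteq\mathcal{M}\}$ for ideals $I$ of $R$. A (left) primitive ideal is the annihilator of a simple left $R$-module; a semiprimitive ideal is an intersection of primitive ideals. $SPm(R)$ is the set consisting of $R$ together with all semiprimitive ideals, ordered by inclusion; it is a frame in which the meet is intersection. A frame is normal if for all $a,b$ with $a\vee b=1$ there exist $a',b'$ with $a\vee b'=1=a'\vee b$ and $a'\wedge b'=0$ (joins, $0$ and $1$ taken in the frame). A topological space is normal if any two disjoint closed subsets are contained respectively in disjoint open subsets (no $T_1$ assumption). *)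

(* Defs.v *)
From HB Require Import structures.
From mathcomp Require Import all_boot all_order all_algebra.
From mathcomp Require Import boolp classical_sets filter.
From mathcomp Require Import topology_structure separation_axioms.

Set Implicit Arguments.
Unset Strict Implicit.
Unset Printing Implicit Defensive.

Import Order.TTheory GRing.Theory.
Local Open Scope classical_set_scope.
Local Open Scope ring_scope.

(* Rings are [pzRingType]s: noncommutative, and possibly zero. *)

Definition maximal_submodule (R : pzRingType) (V : lmodType R) (M : set V) :=
  [/\ submod_closed [in M], M != setT &
      forall N : set V, submod_closed [in N] -> M `<=` N -> N = M \/ N = setT].

Definition simple_module (R : pzRingType) (V : lmodType R) :=
  [set: V] != [set 0] /\
  forall U : set V, submod_closed [in U] -> U = [set 0] \/ U = setT.

Definition annihilator (R : pzRingType) (V : lmodType R) : set R :=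
  [set r | forall v : V, r *: v = 0].

Definition two_sided_ideal (R : pzRingType) (I : set R) :=
  zmod_closed [in I] /\ forall a x, I x -> I (a * x) /\ I (x * a).

Definition primitive_ideal (R : pzRingType) (P : set R) :=
  exists V : lmodType R, simple_module V /\ P = annihilator V.

(* The empty family yields R itself, which [SPm R] contains anyway. *)
Definition semiprimitive_ideal (R : pzRingType) (I : set R) :=
  exists2 F : set (set R), F `<=` @primitive_ideal R & I = \bigcap_(P in F) P.

Section ModuleTheory.
Variable R : pzRingType.
Implicit Types (V : lmodType R) (I J P : set R).

Lemma submod_closedP V (U : set V) :
  submod_closed [in U] <->
  U 0 /\ forall (a : R) u v, U u -> U v -> U (a *: u + v).
Proof.
split=> [[U0 Ul]|[U0 Ul]]; split; first exact/set_mem.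
- by move=> a u v Uu Uv; apply/set_mem/Ul; exact/mem_set.
- exact/mem_set.
- by move=> a u v /set_mem Uu /set_mem Uv; exact/mem_set/Ul.
Qed.

Lemma two_sided_idealP I :
  two_sided_ideal I <->
  [/\ I 0, forall x y, I x -> I y -> I (x - y),
      forall a x, I x -> I (a * x) & forall a x, I x -> I (x * a)].
Proof.
split=> [[[I0 IB] IM]|[I0 IB IMl IMr]].
- split.
  + exact/set_mem.
  + by move=> x y Ix Iy; apply/set_mem/IB; exact/mem_set.
  + by move=> a x /(IM a)[].
  + by move=> a x /(IM a)[].
- split; last by move=> a x Ix; split; [exact: IMl|exact: IMr].
  split; first exact/mem_set.
  by move=> x y /set_mem Ix /set_mem Iy; exact/mem_set/IB.
Qed.

Lemma annihilator_ideal V : two_sided_ideal (@annihilator R V).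
Proof.
apply/two_sided_idealP; split=> /=.
- by move=> v; rewrite scale0r.
- by move=> x y xV yV v; rewrite scalerBl xV yV subrr.
- by move=> a x xV v; rewrite -scalerA xV scaler0.
- by move=> a x xV v; rewrite -scalerA xV.
Qed.

Lemma primitive_is_ideal P : primitive_ideal P -> two_sided_ideal P.
Proof. by move=> [V [_ ->]]; exact: annihilator_ideal. Qed.

Lemma primitive_prime P I J : primitive_ideal P ->
  two_sided_ideal I -> two_sided_ideal J -> I `&` J `<=` P ->
  I `<=` P \/ J `<=` P.
Proof.
move=> [V [[V0 Vs] ->]] /two_sided_idealP[I0 IB IMl IMr].
move=> /two_sided_idealP[J0 JB JMl JMr] IJ.
have [?|/existsNP[j /not_implyP[Jj /existsNP[m jm]]]] :=
  pselect (J `<=` annihilator V); [by right|left=> i Ii v].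
pose U : set V := [set u | exists r, u = (r * j) *: m].
have /submod_closedP/Vs[U0|UT] : U 0 /\
    forall (a : R) u w, U u -> U w -> U (a *: u + w).
- split; first by exists 0; rewrite mul0r scale0r.
  move=> a _ _ [r ->] [s ->]; exists (a * r + s).
  by rewrite mulrDl scalerDl scalerA mulrA.
- have : U (j *: m) by exists 1; rewrite mul1r.
  by rewrite U0 => /jm.
have : [set: V] v by [].
rewrite -UT => -[r ->]; rewrite scalerA; apply: IJ.
split; first exact: IMr.
by rewrite mulrA; exact: JMl.
Qed.

End ModuleTheory.

Record Max (R : pzRingType) := MkMax {
  Max_set :> set R;
  Max_maximal : maximal_submodule (Max_set : set R^o) }.

HB.instance Definition _ (R : pzRingType) := gen_eqMixin (Max R).
HB.instance Definition _ (R : pzRingType) := gen_choiceMixin (Max R).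

Definition Max_hull (R : pzRingType) (I : set R) : set (Max R) :=
  [set M : Max R | I `<=` M].

Section MaxTopology.
Variable R : pzRingType.
Implicit Types (I J : set R) (M : Max R).

Lemma MaxP M :
  [/\ Max_set M 0,
      forall a x y, Max_set M x -> Max_set M y -> Max_set M (a * x + y),
      M <> setT :> set R &
      forall N : set R, N 0 -> (forall a x y, N x -> N y -> N (a * x + y)) ->
        M `<=` N -> N = M \/ N = setT].
Proof.
case: M => M /= [/submod_closedP[M0 Ml] /eqP MT MM]; split=> // N N0 Nl.
by apply: MM; apply/submod_closedP.
Qed.

Lemma Max_hullI I J : two_sided_ideal I -> two_sided_ideal J ->
  Max_hull (I `&` J) = Max_hull I `|` Max_hull J.
Proof.
move=> /two_sided_idealP[I0 IB IMl IMr] /two_sided_idealP[J0 JB JMl JMr].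
apply/seteqP; split=> [M IJM|M [IM|JM] x [Ix Jx]]; [|exact: IM|exact: JM].
have [?|/existsNP[x /not_implyP[Ix Mx]]] := pselect (I `<=` M); first by left.
right=> j Jj; have [M0 Ml MT MM] := MaxP M.
have ID a b : I a -> I b -> I (a + b).
  by move=> Ia Ib; rewrite -[b]opprK; apply: (IB) => //; rewrite -sub0r; exact: IB.
pose N : set R := [set z | exists i m, [/\ I i, Max_set M m & z = i + m]].
have NT : N = setT.
  have [||z Mz|N_M|//] := MM N.
  - by exists 0, 0; rewrite addr0.
  - move=> a _ _ [i [m [Ii Mm ->]]] [k [n [Ik Mn ->]]].
    exists (a * i + k), (a * m + n); split; [|exact: Ml|].
      by apply: ID => //; exact: IMl.
    by rewrite mulrDr addrACA.
  - by exists 0, z; rewrite add0r.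
  - case: Mx; rewrite -[X in X x]N_M.
    by exists x, 0; rewrite addr0.
have : N 1 by rewrite NT.
move=> [i [m [Ii Mm im]]]; rewrite -[j]mulr1 im mulrDr addrC.
by apply: Ml => //; apply: IJM; split; [exact: IMl|exact: JMr].
Qed.

Lemma Max_hull_bigcap (T : Type) (I : T -> set R) :
  (forall t, two_sided_ideal (I t)) ->
  exists2 J, two_sided_ideal J & Max_hull J = \bigcap_t Max_hull (I t).
Proof.
move=> idI.
exists (\bigcap_(J in [set J | two_sided_ideal J /\ forall t, I t `<=` J]) J).
  apply/two_sided_idealP; split.
  - by move=> J [/two_sided_idealP[]].
  - move=> x y Hx Hy J JJ; case: (JJ) => /two_sided_idealP[_ + _ _] _.
    by apply; [exact: Hx|exact: Hy].
  - move=> a x Hx J JJ; case: (JJ) => /two_sided_idealP[_ _ + _] _.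
    by apply; exact: Hx.
  - move=> a x Hx J JJ; case: (JJ) => /two_sided_idealP[_ _ _ +] _.
    by apply; exact: Hx.
apply/seteqP; split=> [M HM t _ x Itx|M HM x].
  by apply: HM => J [_]; apply; exact: Itx.
have [M0 Ml MT MM] := MaxP M.
have MB a b : Max_set M a -> Max_set M b -> Max_set M (a - b).
  by move=> Ma Mb; rewrite addrC -mulN1r; exact: Ml.
pose core : set R := [set r | forall s, Max_set M (r * s)].
move=> /(_ core) corex; rewrite -[x]mulr1; apply: corex; split.
  apply/two_sided_idealP; split=> /=.
  - by move=> s; rewrite mul0r.
  - by move=> a b Ha Hb s; rewrite mulrBl; exact: MB.
  - by move=> a b Hb s; rewrite -mulrA -[X in Max_set M X]addr0; exact: Ml.
  - by move=> a b Hb s; rewrite -mulrA.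
move=> t r Ir s; apply: (HM t) => //.
by have /two_sided_idealP[_ _ _] := idI t; apply.
Qed.

Definition Max_open : set (set (Max R)) :=
  [set U | exists2 I, two_sided_ideal I & ~` U = Max_hull I].

Lemma Max_openT : Max_open setT.
Proof.
exists setT; first by apply/two_sided_idealP.
apply/seteqP; split=> [M|M MT]; first by rewrite setCT.
by have [_ _ MnT _] := MaxP M; case: MnT; apply/seteqP; split.
Qed.

Lemma Max_openI : setI_closed Max_open.
Proof.
move=> U V [I idI UI] [J idJ VJ]; exists (I `&` J).
  move: idI idJ => /two_sided_idealP[I0 IB IMl IMr].
  move=> /two_sided_idealP[J0 JB JMl JMr]; apply/two_sided_idealP; split=> //.
  - by move=> x y [? ?] [? ?]; split; [exact: IB|exact: JB].
  - by move=> a x [? ?]; split; [exact: IMl|exact: JMl].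
  - by move=> a x [? ?]; split; [exact: IMr|exact: JMr].
by rewrite setCI UI VJ Max_hullI.
Qed.

Lemma Max_open_bigU (T : Type) (f : T -> set (Max R)) :
  (forall t, Max_open (f t)) -> Max_open (\bigcup_t f t).
Proof.
move=> /(_ _)/cid2-/all_sig2[I idI fI].
have [J idJ JI] := Max_hull_bigcap idI.
by exists J => //; rewrite setC_bigcup JI; apply: eq_bigcapr => t _.
Qed.

HB.instance Definition _ :=
  isOpenTopological.Build (Max R) Max_openT Max_openI Max_open_bigU.

Lemma Max_closedP (A : set (Max R)) :
  closed A <-> exists2 I, two_sided_ideal I & A = Max_hull I.
Proof.
by rewrite -openC; split=> -[I idI AI]; exists I; rewrite ?setCK // -AI setCK.
Qed.

End MaxTopology.

(* [normal_space] is phrased with closed neighbourhoods and assumes no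
   separation axiom. *)
Lemma normal_spaceE (T : topologicalType) :
  normal_space T <->
  forall A B : set T, closed A -> closed B -> A `&` B = set0 ->
    exists U V, [/\ open U, open V, A `<=` U, B `<=` V & U `&` V = set0].
Proof.
split=> [nT A B clA clB AB0|nT A clA B /set_nbhsP[C [oC AC CB]]].
  have /(nT A clA)[C AC CB] : set_nbhs A (~` B).
    by apply/set_nbhsP; exists (~` B); split;
      [exact: closed_openC|exact/disjoints_subset|].
  have /set_nbhsP[U [oU AU UC]] := AC.
  exists U, (~` closure C); split=> //.
  - by apply: closed_openC; exact: closed_closure.
  - exact/subsetCr.
  - by apply/disjoints_subset; rewrite setCK;
    exact/(subset_trans UC)/subset_closure.
have [|U [V [oU oV AU CV UV0]]] := nT A (~` C) clA (open_closedC oC).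
  by apply/disjoints_subset; rewrite setCK.
exists U; first by apply/set_nbhsP; exists U; split.
apply: subset_trans CB; apply: subset_trans (subsetCl CV).
rewrite ((closure_id _).1 (open_closedC oV)).
by apply/closureS/disjoints_subset.
Qed.

HB.mixin Record TBDistrLattice_isFrame (d : Order.disp_t) T
    of Order.TBDistrLattice d T := {
  bigjoin : set T -> T;
  bigjoin_ub : forall (A : set T) a, A a -> (a <= bigjoin A)%O;
  bigjoin_le : forall (A : set T) b,
    (forall a, A a -> (a <= b)%O) -> (bigjoin A <= b)%O;
  meet_bigjoin : forall (A : set T) b,
    (b `&` bigjoin A)%O = bigjoin [set (b `&` a)%O | a in A] }.

#[short(type="frameType")]
HB.structure Definition Frame d :=
  {T of TBDistrLattice_isFrame d T & Order.TBDistrLattice d T}.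

Definition normal_frame (d : Order.disp_t) (L : frameType d) :=
  forall a b : L, (a `|` b = \top)%O ->
    exists a' b' : L, [/\ (a `|` b' = \top)%O, (a' `|` b = \top)%O
                        & (a' `&` b' = \bot)%O].

Record SPm (R : pzRingType) := MkSPm {
  SPm_set :> set R;
  SPm_semiprimitive : SPm_set = setT \/ semiprimitive_ideal SPm_set }.

HB.instance Definition _ (R : pzRingType) := gen_eqMixin (SPm R).
HB.instance Definition _ (R : pzRingType) := gen_choiceMixin (SPm R).

Fact SPm_display : Order.disp_t. Proof. exact: Order.Disp tt tt. Qed.

Section SPmFrame.
Variable R : pzRingType.
Implicit Types (X Y P : set R) (I J K : SPm R).

Lemma SPm_inj I J : (I = J :> set R) -> I = J.
Proof.
by case: I J => [X pX] [Y pY] /= XY; case: _ / XY pY => pY; congr MkSPm; exact: Prop_irrelevance.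
Qed.

Definition SPm_hull X : set R :=
  \bigcap_(P in [set P | primitive_ideal P /\ X `<=` P]) P.

Lemma sub_SPm_hull X : X `<=` SPm_hull X.
Proof. by move=> x Xx P [_]; exact. Qed.

Lemma SPm_hullP X : X = setT \/ semiprimitive_ideal X <-> SPm_hull X `<=` X.
Proof.
split=> [[->//|[F Fp ->] x Hx P FP]|HX].
  by apply: Hx; split; [exact: Fp|move=> y; exact].
right; exists [set P | primitive_ideal P /\ X `<=` P]; first by move=> P [].
by apply/seteqP; split; [exact: sub_SPm_hull|].
Qed.

Lemma SPm_hull_min X I : X `<=` I -> SPm_hull X `<=` I.
Proof.
have /SPm_hullP HI := SPm_semiprimitive I; move=> XI; apply: subset_trans HI.
by move=> x Hx P [pP IP]; apply: Hx; split=> //; exact: subset_trans IP.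
Qed.

Lemma SPm_is_ideal I : two_sided_ideal (I : set R).
Proof.
have /SPm_hullP HI := SPm_semiprimitive I.
have -> : I = SPm_hull I :> set R.
  by apply/seteqP; split; [exact: sub_SPm_hull|].
apply/two_sided_idealP; split.
- by move=> P [/primitive_is_ideal/two_sided_idealP[]].
- move=> x y Hx Hy P PP.
  case: (PP) => /primitive_is_ideal/two_sided_idealP[_ + _ _] _.
  by apply; [exact: Hx|exact: Hy].
- move=> a x Hx P PP.
  case: (PP) => /primitive_is_ideal/two_sided_idealP[_ _ + _] _.
  by apply; exact: Hx.
- move=> a x Hx P PP.
  case: (PP) => /primitive_is_ideal/two_sided_idealP[_ _ _ +] _.
  by apply; exact: Hx.
Qed.

Lemma SPm_hull_semiprimitive X :
  SPm_hull X = setT \/ semiprimitive_ideal (SPm_hull X).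
Proof.
right; exists [set P | primitive_ideal P /\ X `<=` P] => //.
by move=> P [].
Qed.

Lemma SPm_setI_semiprimitive I J :
  I `&` J = setT \/ semiprimitive_ideal (I `&` J).
Proof.
by apply/SPm_hullP; rewrite subsetI; split; apply: SPm_hull_min => x [].
Qed.

Lemma SPm_setT_semiprimitive :
  [set: R] = setT \/ semiprimitive_ideal [set: R].
Proof. by left. Qed.

Definition SPm_le I J := `[< I `<=` J >].
Definition SPm_meet I J := MkSPm (SPm_setI_semiprimitive I J).
Definition SPm_bigjoin (A : set (SPm R)) :=
  MkSPm (SPm_hull_semiprimitive (\bigcup_(I in A) I)).
Definition SPm_join I J := MkSPm (SPm_hull_semiprimitive (I `|` J)).
Definition SPm_bot := MkSPm (SPm_hull_semiprimitive set0).
Definition SPm_top := MkSPm SPm_setT_semiprimitive.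

Lemma SPm_le_refl : reflexive SPm_le.
Proof. by move=> I; apply/asboolP. Qed.

Lemma SPm_le_anti : antisymmetric SPm_le.
Proof. by move=> I J /andP[/asboolP IJ /asboolP JI]; apply/SPm_inj/seteqP. Qed.

Lemma SPm_le_trans : transitive SPm_le.
Proof.
by move=> J I K /asboolP IJ /asboolP JK; apply/asboolP/(subset_trans IJ).
Qed.

HB.instance Definition _ := Order.Le_isPOrder.Build SPm_display (SPm R)
  SPm_le_refl SPm_le_anti SPm_le_trans.

Lemma SPm_meetP I J K : (I <= SPm_meet J K)%O = (I <= J)%O && (I <= K)%O.
Proof.
apply/asboolP/andP => /=; rewrite subsetI.
  by move=> [? ?]; split; apply/asboolP.
by move=> [/asboolP ? /asboolP ?].
Qed.

Lemma SPm_joinP I J K : (SPm_join I J <= K)%O = (I <= K)%O && (J <= K)%O.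
Proof.
apply/asboolP/andP => [/= H|[/asboolP IK /asboolP JK]].
  split; apply/asboolP => x Hx; apply: H; apply: sub_SPm_hull; first by left.
  by right.
by apply: SPm_hull_min; rewrite subUset.
Qed.

HB.instance Definition _ := Order.POrder_MeetJoin_isLattice.Build
  SPm_display (SPm R) SPm_meetP SPm_joinP.

Lemma SPm_hull_distr I (A : set (SPm R)) :
  I `&` SPm_hull (\bigcup_(J in A) J) `<=`
  SPm_hull (\bigcup_(J in A) (I `&` J)).
Proof.
move=> x [Ix Hx] P [pP IAP].
have [IP|nIP] := pselect (I `<=` P); first exact: IP.
apply: Hx; split=> // y [J AJ Jy].
have [|/nIP//|] := primitive_prime pP (SPm_is_ideal I) (SPm_is_ideal J).
  by apply: subset_trans IAP => z IJz; exists J.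
by apply.
Qed.

Lemma SPm_meetUl : @left_distributive (SPm R) (SPm R) Order.meet Order.join.
Proof.
move=> I J K; rewrite ![(_ `&` K)%O]meetC; apply/le_anti/andP; split.
  have bigU2 (f : SPm R -> set R) :
      \bigcup_(L in [set I; J]) f L = f I `|` f J.
    by rewrite bigcup_setU !bigcup_set1.
  have := @SPm_hull_distr K [set I; J].
  by rewrite (bigU2 (fun L => K `&` L)) (bigU2 (fun L => L)) => /asboolP.
by rewrite leUx !lexI !leIl /= !(le_trans (leIr _ _)) ?leUl ?leUr.
Qed.

HB.instance Definition _ := Order.Lattice_Meet_isDistrLattice.Build
  SPm_display (SPm R) SPm_meetUl.

Lemma SPm_le0 I : (SPm_bot <= I)%O.
Proof. by apply/asboolP; exact: SPm_hull_min. Qed.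

Lemma SPm_le1 I : (I <= SPm_top)%O.
Proof. exact/asboolP. Qed.

HB.instance Definition _ :=
  Order.hasBottom.Build SPm_display (SPm R) SPm_le0.
HB.instance Definition _ :=
  Order.hasTop.Build SPm_display (SPm R) SPm_le1.

Lemma SPm_bigjoin_ub (A : set (SPm R)) I : A I -> (I <= SPm_bigjoin A)%O.
Proof. by move=> AI; apply/asboolP => x Ix; apply: sub_SPm_hull; exists I. Qed.

Lemma SPm_bigjoin_le (A : set (SPm R)) J :
  (forall I, A I -> (I <= J)%O) -> (SPm_bigjoin A <= J)%O.
Proof.
move=> AJ; apply/asboolP; apply: SPm_hull_min => x [I AI Ix].
by have /asboolP := AJ _ AI; apply.
Qed.

Lemma SPm_meet_bigjoin (A : set (SPm R)) I :
  (I `&` SPm_bigjoin A)%O = SPm_bigjoin [set (I `&` J)%O | J in A].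
Proof.
apply/le_anti/andP; split.
  apply/asboolP => x /SPm_hull_distr Hx P [pP HP]; apply: Hx; split=> //.
  by apply: subset_trans HP => y [J AJ IJy]; exists (I `&` J)%O => //; exists J.
apply: SPm_bigjoin_le => _ [J AJ <-].
by rewrite lexI leIl (le_trans (leIr _ _)) // SPm_bigjoin_ub.
Qed.

HB.instance Definition _ := TBDistrLattice_isFrame.Build SPm_display (SPm R)
  SPm_bigjoin_ub SPm_bigjoin_le SPm_meet_bigjoin.

End SPmFrame.

(* Main.v *)
Require Import Defs.
From HB Require Import structures.
From mathcomp Require Import all_boot all_order all_algebra.
From mathcomp Require Import boolp classical_sets filter.
From mathcomp Require Import topology_structure separation_axioms.
From mathcomp Require Import generic_quotient ring_quotient.

Set Implicit Arguments.
Unset Strict Implicit.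
Unset Printing Implicit Defensive.

Import Order.TTheory GRing.Theory.
Local Open Scope classical_set_scope.
Local Open Scope quotient_scope.
Local Open Scope ring_scope.

(** Both normality conditions are the same condition on one lattice, because
    [I |-> Max_hull I] is an order-reversing bijection from [SPm R] onto the
    closed subsets of [Max R].  Under it joins become intersections, meets
    become unions, and the top and bottom become the empty set and the whole
    space.  Hence [a] and [b] join to the top exactly when their hulls are
    disjoint, and [a'] and [b'] meet to the bottom exactly when their hulls
    cover the space, that is, when the complementary open sets are disjoint.
    Complementing the witnesses turns one normality condition into the other.

    The bijection rests on two facts comparing maximal left ideals with
    primitive ideals.
    - Injectivity: if [V] is simple, its annihilator is the intersection of the
      annihilators of its nonzero vectors, which are maximal left ideals
      ([ann_maximal]).  So a semiprimitive ideal is an intersection of maximal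
      left ideals and is recovered from its hull ([Max_hull_subset]).
    - Surjectivity: the largest ideal contained in a maximal left ideal [M] is
      the annihilator of the simple module [R / M], hence primitive
      ([core_primitive]).  So every maximal left ideal containing an ideal [X]
      contains a primitive ideal containing [X], and therefore contains the
      semiprimitive closure of [X] ([Max_hull_SPm_hull]). *)

(** * Quotients of a module by a submodule *)

Section QuotientModule.
Variables (R : pzRingType) (V : lmodType R).

(** The proof that [U] is a submodule is kept in the predicate, so that the
    quotient type carries it and the module structure on the quotient can be
    inferred. *)
Definition submod_pred (U : set V) of submod_closed [in U] : pred V := [in U].

Variables (U : set V) (clU : submod_closed [in U]).

HB.instance Definition _ :=
  GRing.isZmodClosed.Build V (submod_pred clU) (GRing.submod_closedB clU).

Definition submod_quot :=
  Quotient.quot (GRing.ZmodClosed.clone V (submod_pred clU) _).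

Local Notation Q := submod_quot.

HB.instance Definition _ := GRing.Zmodule.on Q.

Lemma submod_quot_eq u v : \pi_Q u = \pi_Q v <-> U (u - v).
Proof.
split=> [/eqP|Uuv]; [move=> uv|apply/eqP; move: Uuv => /mem_set].
  by apply/set_mem; move: uv; rewrite -Quotient.idealrBE.
by rewrite -Quotient.idealrBE.
Qed.

Definition quot_scale (a : R) (q : Q) : Q := \pi_Q (a *: repr q).

Lemma pi_scale a v : \pi_Q (a *: v) = quot_scale a (\pi_Q v).
Proof.
apply/submod_quot_eq; rewrite -scalerBr.
have /submod_closedP[U0 Ul] := clU.
by rewrite -[_ *: _]addr0; apply: Ul => //; apply/submod_quot_eq; rewrite reprK.
Qed.

Lemma quot_scaleA a b q : quot_scale a (quot_scale b q) = quot_scale (a * b) q.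
Proof.
by rewrite -[q]reprK -(pi_scale b) -(pi_scale a) -pi_scale scalerA.
Qed.

Lemma quot_scale1 : left_id 1 quot_scale.
Proof. by move=> q; rewrite -[q]reprK -pi_scale scale1r. Qed.

Lemma quot_scaleDr : right_distributive quot_scale +%R.
Proof.
move=> a p q; rewrite -[p]reprK -[q]reprK.
by rewrite -!pi_scale -!pi_addr -pi_scale scalerDr.
Qed.

Lemma quot_scaleDl q : {morph quot_scale^~ q : a b / a + b}.
Proof.
move=> a b; rewrite -[q]reprK -!pi_scale.
by rewrite scalerDl pi_addr.
Qed.

HB.instance Definition _ := GRing.Zmodule_isLmodule.Build R Q
  quot_scaleA quot_scale1 quot_scaleDr quot_scaleDl.

End QuotientModule.

(** The quotient module through its universal features only: from here on a
    quotient is any surjective linear map with the prescribed kernel. *)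
Lemma submod_quotient (R : pzRingType) (V : lmodType R) (U : set V) :
  submod_closed [in U] ->
  exists (W : lmodType R) (f : {linear V -> W}),
    (forall w, exists v, f v = w) /\ (forall v, f v = 0 <-> U v).
Proof.
move=> clU; pose Q : lmodType R := submod_quot clU.
have pi_lin : linear (\pi_Q : V -> Q).
  by move=> a u v; rewrite pi_addr pi_scale.
pose fL := GRing.isLinear.Build R V Q *:%R (\pi_Q : V -> Q) pi_lin.
pose f : {linear V -> Q} := HB.pack (\pi_Q : V -> Q) fL.
exists Q, f; split=> [w|v]; first by exists (repr w); exact: reprK.
by rewrite -[v in U v]subr0 -(submod_quot_eq clU) pi_zeror.
Qed.

(** Preimages of submodules of [W] are submodules of [V] containing [U], so
    maximality of [U] leaves only two of them. *)
Lemma simple_quotient (R : pzRingType) (V W : lmodType R) (U : set V)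
    (f : {linear V -> W}) :
  maximal_submodule U -> (forall w, exists v, f v = w) ->
  (forall v, f v = 0 <-> U v) -> simple_module W.
Proof.
move=> [_ /eqP UT Umax] fsurj fker; split.
  apply/eqP => W0; apply: UT; apply/seteqP; split=> // v _.
  by apply/fker; have : [set: W] (f v) by []; rewrite W0.
move=> X clX; have /submod_closedP[X0 Xl] := clX.
have [|v /fker fv|fX|fX] := Umax (f @^-1` X).
- apply/submod_closedP; split; first by rewrite /preimage /= raddf0.
  by move=> a u v Xu Xv; rewrite /preimage /= linearP; exact: Xl.
- by rewrite /preimage /= fv.
- left; apply/seteqP; split=> [w Xw|w ->] //.
  have [v fv] := fsurj w; rewrite -fv; apply/fker.
  by rewrite -fX /preimage /= fv.
- right; apply/seteqP; split=> // w _; have [v <-] := fsurj w.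
  by have : [set: V] v by []; rewrite -fX.
Qed.

(** * Maximal left ideals and primitive ideals *)

Section MaxPrimitive.
Variable R : pzRingType.
Implicit Types (M : Max R) (X : set R) (I J : SPm R).

(** The largest two-sided ideal inside [M], and also the annihilator of the
    module [R / M]. *)
Definition core M : set R := [set r | forall s, Max_set M (r * s)].

Lemma core_sub M : core M `<=` M.
Proof. by move=> r /(_ 1); rewrite mulr1. Qed.

Lemma ideal_sub_core M X :
  (forall a x, X x -> X (x * a)) -> X `<=` M -> X `<=` core M.
Proof. by move=> Xr XM x Xx s; apply: XM; exact: Xr. Qed.

(** An element [r] kills [R / M] when it sends the class of every [s] to zero,
    which is the condition defining [core M]. *)
Lemma core_primitive M : primitive_ideal (core M).
Proof.
have [clM _ _] := Max_maximal M.
have [W [f [fsurj fker]]] := submod_quotient clM.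
exists W; split; first exact: (simple_quotient (Max_maximal M) fsurj fker).
apply/seteqP; split=> [r rM w|r rW s].
  by have [s <-] := fsurj w; rewrite -linearZ; apply/fker; exact: rM.
by apply/fker; rewrite -[r * s]/(r *: (s : R^o)) linearZ; exact: rW.
Qed.

(** The cyclic submodule generated by [v] is not zero, hence is everything. *)
Lemma simple_module_gen (V : lmodType R) (v w : V) :
  simple_module V -> v <> 0 -> exists r, r *: v = w.
Proof.
move=> [_ Vs] v0; pose U : set V := [set u | exists r, r *: v = u].
have /submod_closedP/Vs[U0|UT] :
    U 0 /\ forall (a : R) x y, U x -> U y -> U (a *: x + y).
- split; first by exists 0; rewrite scale0r.
  move=> a _ _ [r <-] [s <-]; exists (a * r + s).
  by rewrite scalerDl scalerA.
- by have : U v by [exists 1; rewrite scale1r]; rewrite U0 => /v0.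
- by have : [set: V] w by []; rewrite -UT.
Qed.

(** By simplicity, a left ideal containing an [r] with [r *: v <> 0] moves [v]
    everywhere: any [s *: v] equals some [(t * r) *: v], and [s - t * r] kills
    [v]. *)
Lemma ann_maximal (V : lmodType R) (v : V) : simple_module V -> v <> 0 ->
  maximal_submodule ([set r | r *: v = 0] : set R^o).
Proof.
move=> Vs v0; split.
- apply/submod_closedP; split=> [|a x y /= xv yv]; first exact: scale0r.
  by rewrite scalerDl -scalerA xv yv scaler0 addr0.
- apply/eqP => annT; apply: v0; rewrite -[v]scale1r.
  by have : [set: R] 1 by []; rewrite -annT.
move=> N /submod_closedP[N0 Nl] annN.
have [NA|/existsNP[r /not_implyP[Nr rv]]] :=
  pselect (N `<=` [set r | r *: v = 0]); [left|right]; apply/seteqP; split=> //.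
move=> s _; have [t ts] := simple_module_gen ((s : R) *: v) Vs rv.
have -> : s = t *: (r : R^o) + (s - t * r) by rewrite addrC subrK.
apply: Nl => //; apply: annN => /=.
by rewrite scalerBl -scalerA ts subrr.
Qed.

(** The maximal left ideals needed are the annihilators of the nonzero vectors
    of a simple module whose annihilator is [P]. *)
Lemma primitive_bigcap_Max P x :
  primitive_ideal P -> (forall M, P `<=` M -> Max_set M x) -> P x.
Proof.
move=> [V [Vs ->]] Hx v; have [->|/eqP v0] := eqVneq v 0; first exact: scaler0.
by apply: (Hx (MkMax (ann_maximal Vs v0))) => r /(_ v).
Qed.

(** * Semiprimitive ideals as closed sets of maximal left ideals *)

(** The substantial direction holds because [I], being an intersection of
    primitive ideals, is the intersection of the maximal left ideals in its
    hull. *)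
Lemma Max_hull_subset I J : (Max_hull I `<=` Max_hull J) <-> J `<=` I.
Proof.
split=> [IJ x Jx|JI M]; last exact: subset_trans.
have /SPm_hullP := SPm_semiprimitive I; apply=> P [pP IP].
apply: primitive_bigcap_Max => // M PM.
by apply: (IJ M) => //; exact: subset_trans PM.
Qed.

Lemma Max_hull_inj : injective (fun I => Max_hull I).
Proof.
move=> I J IJ; apply/SPm_inj/seteqP.
by split; apply/Max_hull_subset; rewrite IJ.
Qed.

(** If [X] lies in [M] then it lies in the core of [M], one of the primitive
    ideals whose intersection is [SPm_hull X].  The set [X] is only
    asked to be stable under right multiplication, so that it can be the union
    of two ideals or the empty set, from which the join and the bottom of
    [SPm R] are built. *)
Lemma Max_hull_SPm_hull X : (forall a x, X x -> X (x * a)) ->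
  Max_hull (SPm_hull X) = Max_hull X.
Proof.
move=> Xr; apply/seteqP; split=> M XM.
  by apply: subset_trans XM; exact: sub_SPm_hull.
move=> x Hx; apply: core_sub; apply: Hx.
by split; [exact: core_primitive|exact: ideal_sub_core].
Qed.

Lemma closed_Max_hull (A : set (Max R)) :
  closed A <-> exists I : SPm R, A = Max_hull I.
Proof.
rewrite Max_closedP; split=> [[X idX ->]|[I ->]]; last first.
  by exists (I : set R) => //; exact: SPm_is_ideal.
exists (MkSPm (SPm_hull_semiprimitive X)).
by rewrite Max_hull_SPm_hull //; case/two_sided_idealP: idX.
Qed.

Lemma Max_hull_join I J : Max_hull (I `|` J)%O = Max_hull I `&` Max_hull J.
Proof.
rewrite -[RHS]/([set M : Max R | _]) Max_hull_SPm_hull.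
  by apply/seteqP; split=> M; rewrite /Max_hull /= subUset.
have /two_sided_idealP[_ _ _ Ir] := SPm_is_ideal I.
have /two_sided_idealP[_ _ _ Jr] := SPm_is_ideal J.
by move=> a x [/Ir|/Jr]; [left|right].
Qed.

Lemma Max_hull_meet I J : Max_hull (I `&` J)%O = Max_hull I `|` Max_hull J.
Proof. by rewrite -Max_hullI //; exact: SPm_is_ideal. Qed.

Lemma Max_hull_top : Max_hull (\top%O : SPm R) = set0.
Proof.
apply/seteqP; split=> // M TM; have [_ _ MT _] := MaxP M.
by apply: MT; apply/seteqP; split.
Qed.

Lemma Max_hull_bot : Max_hull (\bot%O : SPm R) = setT.
Proof. by rewrite Max_hull_SPm_hull //; apply/seteqP; split=> // M _ x. Qed.

Lemma Max_hull_disjoint I J :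
  Max_hull I `&` Max_hull J = set0 <-> (I `|` J)%O = \top%O.
Proof.
rewrite -Max_hull_join -Max_hull_top.
by split=> [/Max_hull_inj|->].
Qed.

Lemma Max_hull_cover I J :
  Max_hull I `|` Max_hull J = setT <-> (I `&` J)%O = \bot%O.
Proof.
rewrite -Max_hull_meet -Max_hull_bot.
by split=> [/Max_hull_inj|->].
Qed.

End MaxPrimitive.

Theorem corollary3p12 (R : pzRingType) :
  normal_space (Max R) <-> normal_frame (SPm R).
Proof.
rewrite normal_spaceE; split=> [nMax I J /Max_hull_disjoint IJ|nSPm].
  have clI (K : SPm R) : closed (Max_hull K) by apply/closed_Max_hull; exists K.
  have [U [V [oU oV IU JV UV]]] := nMax _ _ (clI I) (clI J) IJ.
  have /closed_Max_hull[I' UI'] := open_closedC oU.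
  have /closed_Max_hull[J' VJ'] := open_closedC oV.
  (* [I'] and [J'] cut out the complements of [U] and [V]; they trade places
     because [I'] is the one that is comaximal with [I]. *)
  exists J', I'; split.
  - apply/Max_hull_disjoint; rewrite -UI'.
    by apply/disjoints_subset; rewrite setCK.
  - rewrite joinC; apply/Max_hull_disjoint; rewrite -VJ'.
    by apply/disjoints_subset; rewrite setCK.
  - by apply/Max_hull_cover; rewrite -UI' -VJ' -setCI setIC UV setC0.
move=> A B /closed_Max_hull[I ->] /closed_Max_hull[J ->] /Max_hull_disjoint.
move=> /nSPm[J' [I' [II' J'J J'I']]].
have oC (K : SPm R) : open (~` Max_hull K).
  by apply: closed_openC; apply/closed_Max_hull; exists K.
exists (~` Max_hull I'), (~` Max_hull J'); split=> //.
- by apply/disjoints_subset/Max_hull_disjoint.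
- by apply/disjoints_subset/Max_hull_disjoint; rewrite joinC.
- by rewrite -setCU setUC; move/Max_hull_cover: J'I' => ->; rewrite setCT.
Qed.
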